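(* Let $t$ be a positive integer and let $S$ be a skew-symmetric EW matrix of order $4t+2$. Then the Smith normal form of $S$ is \[ \operatorname{diag}[1,\underbrace{2,\dots,2}_{2t+1},\underbrace{2t,\dots,2t}_{2t-1},2t(4t+1)]. \]
   Context: For $n\equiv 2\pmod 4$, a $\{1,-1\}$-matrix $B$ of order $n$ is called an EW matrix if \[ BB^\top=B^\top B=\begin{pmatrix}(n-2)I_{n/2}+2J_{n/2} & O\\ O & (n-2)I_{n/2}+2J_{n/2}\end{pmatrix}, \] where $I$ is the identity matrix, $J$ the all-ones matrix and $O$ the zero matrix. A $\{1,-1\}$-matrix $X$ is called skew-symmetric if $X+X^\top=2I$ (i.e. $X-I$ is skew-symmetric in the usual sense). Two $n\times n$ integer matrices $M,N$ are equivalent if $N=PMQ$ for unimodular integer matrices $P,Q$. Every $n\times n$ integer matrix $M$ is equivalent to a unique diagonal matrix $\operatorname{diag}[m_1,\dots,m_n]$ with nonnegative integers $m_i$ satisfying $m_i\mid m_{i+1}$ for all $i$; this is the Smith normal form of $M$, and $m_1,\dots,m_n$ are the invariant factors of $M$. *)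

(* Defs.v *)
From HB Require Import structures.
From mathcomp Require Import all_boot all_order all_algebra.
From mathcomp Require Import zify.

Set Implicit Arguments.
Unset Strict Implicit.
Unset Printing Implicit Defensive.

Import Order.TTheory GRing.Theory Num.Theory.
Local Open Scope ring_scope.

Definition pm1_matrix (n : nat) (B : 'M[int]_n) : Prop :=
  forall i j, B i j = 1 \/ B i j = -1.

(* The order n = m + m is presented as the sum of its two halves, so that
   the 2 x 2 block form is literally a block_mx. *)
Definition EW_gram (m : nat) : 'M[int]_(m + m) :=
  let D : 'M[int]_m := ((m + m)%:Z - 2)%:M + 2 *: const_mx 1 in
  block_mx D 0 0 D.

Definition EW_matrix (m : nat) (B : 'M[int]_(m + m)) : Prop :=
  [/\ (m + m = 2 %[mod 4])%N,
      pm1_matrix B,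
      B *m B^T = EW_gram m
    & B^T *m B = EW_gram m].

(* For a {1,-1}-matrix X: this is skew-symmetry of X - I, not of X. *)
Definition skew_pm1 (n : nat) (X : 'M[int]_n) : Prop :=
  X + X^T = 2 *: 1%:M.

(* Over int, membership in unitmx means determinant 1 or -1. *)
Definition mx_equivalent (n : nat) (M N : 'M[int]_n) : Prop :=
  exists P Q : 'M[int]_n,
    [/\ P \in unitmx, Q \in unitmx & N = P *m M *m Q].

Definition is_Smith_normal_form (n : nat) (M D : 'M[int]_n) : Prop :=
  [/\ is_diag_mx D,
      forall i : 'I_n, 0 <= D i i,
      forall i j : 'I_n, j = i.+1 :> nat -> (D i i %| D j j)%Z
    & mx_equivalent M D].

(* Entries of s beyond position n are dropped and missing ones read as 0. *)
Definition diag_of_seq (n : nat) (s : seq int) : 'M[int]_n :=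
  diag_mx (\row_(i < n) s`_i).

Definition skew_EW_factors (t : nat) : seq int :=
  1 :: nseq (2 * t + 1) (2 : int)
    ++ nseq (2 * t - 1) (2 * t%:Z)
    ++ [:: 2 * t%:Z * (4 * t%:Z + 1)].

Lemma size_skew_EW_factors (t : nat) :
  (0 < t)%N ->
  size (skew_EW_factors t) = ((2 * t + 1) + (2 * t + 1))%N.
Proof.
by move=> t0; rewrite /= size_cat !size_nseq /= size_cat size_nseq /=; lia.
Qed.

(* Main.v *)
Require Import Defs.
From HB Require Import structures.
From mathcomp Require Import all_boot all_order all_algebra.
From mathcomp Require Import zify ring.

(* Let n = 4t+2, let K be the block diagonal matrix of two all-ones blocks, and
   write S = L D R with L, R unimodular and D = diag(d_0, ..., d_(n-1)). Since
   S commutes with K, the integer matrix T = ((4t+1) S^T - S^T K) / 2 satisfies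
   S T = N I with N = 2t(4t+1), so Q = R T L is diagonal with d_i Q_i = N.
   - S is congruent to the all-ones matrix mod 2 and has odd entries, so d_0 is
     a unit and d_i is even for i > 0.
   - T has entries 2t and -(2t+1), so Q_(n-1) is a unit; S^T K has rank one mod
     4t+1, so 4t+1 divides Q_(n-2), that is, d_(n-2) divides 2t.
   - For a prime p dividing t, T + T^T is congruent to I - K, of rank at least
     4t; the rows of R killed by T mod p span a totally isotropic space, so there
     are at most 2t+2 of them. Hence 2t divides d_i for i >= 2t+2.
   - For such p, if 2p divided d_(2t+1), the last n/2 rows of L^-1 would span,
     mod p, a Lagrangian subspace for the standard form, since S + S^T = 2I.
     By S S^T = 4tI + 2K this subspace is orthogonal to the indicator vectors of
     the two halves, hence contains them; but they have norm 2t+1 = 1 mod p.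
     Hence d_i divides 2 for i <= 2t+1. *)

Set Implicit Arguments.
Unset Strict Implicit.
Unset Printing Implicit Defensive.

Import Order.TTheory GRing.Theory Num.Theory.
Local Open Scope ring_scope.

(** * Ranks of isotropic spaces, rank-one congruences and reduction modulo a prime *)

Lemma isotropic_rank (F : fieldType) (k n : nat) (U : 'M[F]_(k, n))
    (M : 'M[F]_n) :
  row_free U -> U *m M *m U^T = 0 -> (\rank M + 2 * k <= 2 * n)%N.
Proof.
move=> /eqP rU UMU.
(* Sylvester's rank inequality for [U *m M], then for its product with [U^T], which vanishes. *)
have := mxrank_mul_min (U *m M) U^T; have := mxrank_mul_min U M.
by rewrite UMU mxrank0 mxrank_tr rU; lia.
Qed.

Lemma row_free_rowsub (F : fieldType) (k n : nat) (f : 'I_k -> 'I_n)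
    (A : 'M[F]_n) :
  injective f -> A \in unitmx -> row_free (rowsub f A).
Proof.
move=> injf uA; rewrite rowsubE /row_free mxrankMfree ?row_free_unit //.
apply/row_freeP; exists (rowsub f 1%:M)^T.
apply/matrixP=> i j; rewrite !mxE (bigD1 (f i)) //= !mxE eqxx mul1r.
rewrite big1 ?addr0 => [|l li]; last first.
  by rewrite !mxE eq_sym (negbTE li) mul0r.
by rewrite (inj_eq injf) eq_sym.
Qed.

(** Modulo [c] the 2 x 2 minors of [Q] vanish, and [Q i j = 0] reduces the one on rows and columns
    [i], [j] to its diagonal product. *)
Lemma rank1_diag (n : nat) (c : int) (Q Z : 'M[int]_n) (u : 'cV[int]_n)
    (v : 'rV[int]_n) (i j : 'I_n) :
  Q = u *m v + c *: Z -> Q i j = 0 -> (c %| Q i i * Q j j)%Z.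
Proof.
move=> defQ Qij.
have QE a b : Q a b = u a 0 * v 0 b + c * Z a b.
  by rewrite defQ !mxE big_ord1.
suff -> : Q i i * Q j j = Q i i * Q j j - Q i j * Q j i.
  rewrite !QE; apply/dvdzP.
  exists (Z i i * (u j 0 * v 0 j) + u i 0 * v 0 i * Z j j + c * Z i i * Z j j
    - Z i j * (u j 0 * v 0 i) - u i 0 * v 0 j * Z j i - c * Z i j * Z j i).
  by ring.
by rewrite Qij mul0r subr0.
Qed.

Definition mx_mod (p k n : nat) (A : 'M[int]_(k, n)) : 'M['F_p]_(k, n) :=
  map_mx intr A.

Lemma dvdz_mx (k n : nat) (c : int) (A : 'M[int]_(k, n)) :
  (forall i j, (c %| A i j)%Z) -> exists Z, A = c *: Z.
Proof.
move=> cA; exists (map_mx (fun x => (x %/ c)%Z) A).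
by apply/matrixP=> i j; rewrite !mxE mulrC divzK.
Qed.

Lemma scalemx2_inj (k n : nat) : injective (fun A : 'M[int]_(k, n) => 2 *: A).
Proof.
move=> A B /matrixP e; apply/matrixP=> i j; have := e i j.
by rewrite !mxE; apply: mulfI.
Qed.

Section ModPrime.

Variables (p : nat) (p_pr : prime p).

Lemma mx_modM (k l n : nat) (A : 'M[int]_(k, l)) (B : 'M[int]_(l, n)) :
  mx_mod p (A *m B) = mx_mod p A *m mx_mod p B.
Proof. exact: map_mxM. Qed.

Lemma mx_modB (k n : nat) (A B : 'M[int]_(k, n)) :
  mx_mod p (A - B) = mx_mod p A - mx_mod p B.
Proof. exact: map_mxB. Qed.

Lemma mx_mod1 (n : nat) : mx_mod p (1%:M : 'M_n) = 1%:M.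
Proof. exact: map_mx1. Qed.

Lemma mx_mod_tr (k n : nat) (A : 'M[int]_(k, n)) :
  mx_mod p A^T = (mx_mod p A)^T.
Proof. by rewrite /mx_mod map_trmx. Qed.

Lemma mx_mod_scale0 (k n : nat) (A : 'M[int]_(k, n)) :
  mx_mod p (p%:Z *: A) = 0.
Proof.
rewrite /mx_mod map_mxZ /=.
suff -> : (p%:Z)%:~R = 0 :> 'F_p by rewrite scale0r.
by apply/eqP; rewrite -(dvdz_pcharf (pchar_Fp p_pr)).
Qed.

Lemma mx_mod_unit (n : nat) (A : 'M[int]_n) :
  A \in unitmx -> mx_mod p A \in unitmx.
Proof. by rewrite !unitmxE det_map_mx => /rmorph_unit ->. Qed.

End ModPrime.

(** * Indicator vectors of the two halves and the block all-ones matrix *)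

Definition half_sums (R : pzRingType) (m : nat) : 'M[R]_(1 + 1, m + m) :=
  block_mx (const_mx 1) 0 0 (const_mx 1).

Definition half_ones (R : pzRingType) (m : nat) : 'M[R]_(m + m) :=
  block_mx (const_mx 1) 0 0 (const_mx 1).

Lemma mulmx_const (R : pzRingType) (k l n : nat) (a b : R) :
  (const_mx a : 'M_(k, l)) *m (const_mx b : 'M_(l, n)) =
  const_mx (l%:R * (a * b)).
Proof.
apply/matrixP=> i j; rewrite !mxE.
under eq_bigr do rewrite !mxE.
by rewrite sumr_const card_ord mulr_natl.
Qed.
Arguments mulmx_const [R k] l [n] a b.

Lemma half_onesE (R : pzRingType) (m : nat) :
  half_ones R m = (half_sums R m)^T *m half_sums R m.
Proof.
rewrite tr_block_mx mulmx_block !trmx0 !trmx_const !(mul0mx, mulmx0).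
by rewrite !(addr0, add0r) !mulmx_const !mul1r.
Qed.

Lemma half_sums_gram (R : pzRingType) (m : nat) :
  half_sums R m *m (half_sums R m)^T = (m%:R)%:M.
Proof.
rewrite tr_block_mx mulmx_block !trmx0 !trmx_const !(mul0mx, mulmx0).
rewrite !(addr0, add0r) !mulmx_const !mulr1 [RHS]scalar_mx_block.
by congr block_mx; apply/matrixP=> i j; rewrite !mxE !ord1.
Qed.

Lemma half_ones_tr (R : pzRingType) (m : nat) :
  (half_ones R m)^T = half_ones R m.
Proof. by rewrite tr_block_mx !trmx0 !trmx_const. Qed.

Lemma half_ones_sqr (R : comPzRingType) (m : nat) :
  half_ones R m *m half_ones R m = m%:R *: half_ones R m.
Proof.
rewrite [in LHS]half_onesE -mulmxA (mulmxA _ _^T) half_sums_gram.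
by rewrite mul_scalar_mx -scalemxAr -half_onesE.
Qed.

Lemma half_ones_rank (F : fieldType) (m : nat) : (\rank (half_ones F m) <= 2)%N.
Proof. by rewrite half_onesE (leq_trans (mxrankM_maxr _ _)) ?rank_leq_row. Qed.

Lemma mx_mod_half_sums (p m : nat) :
  mx_mod p (half_sums int m) = half_sums 'F_p m.
Proof. by rewrite /mx_mod map_block_mx !map_mx0 !map_const_mx rmorph1. Qed.

Lemma mx_mod_half_ones (p m : nat) :
  mx_mod p (half_ones int m) = half_ones 'F_p m.
Proof. by rewrite /mx_mod map_block_mx !map_mx0 !map_const_mx rmorph1. Qed.

Lemma nth_skew_EW_factors (t i : nat) :
    (0 < t)%N -> (i < 2 * t + 1 + (2 * t + 1))%N ->
  (skew_EW_factors t)`_i =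
  if i == 0%N then 1 else if (i <= 2 * t + 1)%N then 2
  else if (i < 4 * t + 1)%N then 2 * t%:Z else 2 * t%:Z * (4 * t%:Z + 1).
Proof.
move=> t_gt0 lti; case: i lti => //= i lti.
rewrite nth_cat size_nseq nth_nseq; case: ltnP => // lei.
rewrite nth_cat size_nseq nth_nseq.
have -> : (i - (2 * t + 1) < 2 * t - 1)%N = (i.+1 < 4 * t + 1)%N by lia.
case: ifP => [->|ge_i] //.
by have -> : (i - (2 * t + 1) - (2 * t - 1))%N = 0%N by lia.
Qed.

Lemma EW_gramE (t : nat) :
  EW_gram (2 * t + 1) = (4 * t%:Z)%:M + 2 *: half_ones int (2 * t + 1).
Proof.
rewrite [in RHS](scalar_mx_block (2 * t + 1)) scale_block_mx !scaler0.
rewrite add_block_mx !addr0 /EW_gram.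
by have -> : (2 * t + 1 + (2 * t + 1))%:Z - 2 = 4 * t%:Z by lia.
Qed.

(** Entry (i, j) of one product is the sum of row i, of the other the sum of column j; hence all row
    and column sums agree. *)
Lemma comm_const_mx (R : comPzRingType) (m : nat) (X : 'M[R]_m) :
    (0 < m)%N -> X *m const_mx 1 = (const_mx 1 : 'M_m) *m X ->
  exists2 x, X *m const_mx 1 = const_mx x :> 'M_m
    & X^T *m const_mx 1 = const_mx x :> 'M_m.
Proof.
move=> m_gt0 comX; pose i0 := Ordinal m_gt0.
have XE i j : \sum_k X i k = \sum_k X k j.
  have := congr1 (fun M : 'M_m => M i j) comX; rewrite !mxE.
  by under eq_bigr do rewrite mxE mulr1; under [in RHS]eq_bigr do
    rewrite mxE mul1r.
exists (\sum_k X i0 k); apply/matrixP=> i j; rewrite !mxE.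
  under eq_bigr do rewrite mxE mulr1.
  by rewrite (XE i i0) (XE i0 i0).
under eq_bigr do rewrite !mxE mulr1.
by rewrite (XE i0 i).
Qed.

(** * Block sums of a skew EW matrix and the complementary matrix [T] *)

Section SkewEW.

Variables (t : nat) (S : 'M[int]_((2 * t + 1) + (2 * t + 1))).
Hypotheses (t_gt0 : (0 < t)%N) (hEW : EW_matrix S) (hskew : skew_pm1 S).

Local Notation m := (2 * t + 1)%N.
Local Notation K := (half_ones int m).
Local Notation N := (2 * t%:Z * (4 * t%:Z + 1)).

Let gramE : S *m S^T = (4 * t%:Z)%:M + 2 *: K.
Proof. by rewrite -EW_gramE; case: hEW. Qed.

Let gramE' : S^T *m S = (4 * t%:Z)%:M + 2 *: K.
Proof. by rewrite -EW_gramE; case: hEW. Qed.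

(** Expand [S *m S^T *m S] in two ways: both Gram matrices are the same. *)
Lemma skew_EW_comm : S *m K = K *m S.
Proof.
have : S *m (S^T *m S) = S *m S^T *m S by rewrite mulmxA.
rewrite gramE gramE' mulmxDr mulmxDl scalar_mxC -scalemxAr -scalemxAl.
by move/addrI/scalemx2_inj.
Qed.

Lemma skew_EW_diag (i : 'I_(m + m)) : S i i = 1.
Proof.
move/matrixP/(_ i i): hskew; rewrite !mxE eqxx mulr1; move: (S i i) => x; lia.
Qed.

(** Commuting with [K] gives each block of [S] constant row and column sums; skewness makes them 1
    in the diagonal blocks and opposite in the other two. *)
Lemma skew_EW_trmul : exists2 b : int, b ^+ 2 = 8 * t%:Z + 1 &
  S^T *m K = block_mx (const_mx 1) (const_mx (- b)) (const_mx b) (const_mx 1).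
Proof.
have m_gt0 : (0 < m)%N by lia.
pose J : 'M[int]_m := const_mx 1.
have := skew_EW_comm; move: hskew gramE; rewrite /skew_pm1 -(submxK S).
set A := ulsubmx S; set B := ursubmx S.
set C := dlsubmx S; set D := drsubmx S.
rewrite [in 1%:M]scalar_mx_block scale_block_mx tr_block_mx add_block_mx.
move=> /eq_block_mx[skA skB skC skD] gramS.
rewrite !mulmx_block !mulmx0 !mul0mx !addr0 !add0r.
move=> /eq_block_mx[comA comB comC comD].
have [a AJ ATJ] := comm_const_mx m_gt0 comA.
have [b BJ BTJ] := comm_const_mx m_gt0 comB.
have [c CJ CTJ] := comm_const_mx m_gt0 comC.
have [d DJ DTJ] := comm_const_mx m_gt0 comD.
pose i0 := Ordinal m_gt0.
have skew_sum (X : 'M[int]_m) x : X *m J = const_mx x ->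
    X^T *m J = const_mx x -> X + X^T = 2 *: 1%:M -> x = 1.
  move=> XJ XTJ /(congr1 (mulmx^~ J)); rewrite mulmxDl XJ XTJ -scalemxAl mul1mx.
  by move/matrixP/(_ i0 i0); rewrite !mxE; lia.
have a1 := skew_sum _ _ AJ ATJ skA; have d1 := skew_sum _ _ DJ DTJ skD.
subst a d.
have cb : c = - b.
  move/(congr1 (mulmx^~ J)): skC.
  rewrite scaler0 mul0mx mulmxDl CJ BTJ.
  by move/matrixP/(_ i0 i0); rewrite !mxE; lia.
have STK : block_mx A^T C^T B^T D^T *m K =
    block_mx (const_mx 1) (const_mx (- b)) (const_mx b) (const_mx 1).
  rewrite mulmx_block !mulmx0 !addr0 !add0r.
  by congr block_mx; rewrite ?ATJ ?BTJ ?CTJ ?DTJ ?cb.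
exists b; last by rewrite ATJ CTJ BTJ DTJ cb.
(* The upper left block of [S *m S^T *m K] reads 1 + b^2 = 4t + 2m. *)
move/(congr1 (mulmx^~ K)): gramS.
rewrite -mulmxA STK mulmxDl -scalemxAl half_ones_sqr mul_scalar_mx.
rewrite mulmx_block !scale_block_mx add_block_mx => /eq_block_mx[+ _ _ _].
have -> : const_mx b = b *: J by apply/matrixP=> i j; rewrite !mxE mulr1.
rewrite -scalemxAr BJ AJ.
by move/matrixP/(_ i0 i0); rewrite !mxE; lia.
Qed.

(** Modulo 2, [S] is all ones and [m] is odd, so both terms on the right are all ones. Writing S = J
    + 2Z and halving gives the witness, whose leading [t] is (4t + 1 - m) / 2. *)
Lemma skew_EW_complement : exists T : 'M[int]_(m + m),
  2 *: T = (4 * t%:Z + 1) *: S^T - S^T *m K.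
Proof.
have [_ pmS _ _] := hEW.
pose Z := map_mx (fun x : int => ((x - 1) %/ 2)%Z) S.
have SZ : S = const_mx 1 + 2 *: Z.
  by apply/matrixP=> i j; rewrite !mxE; case: (pmS i j) => ->.
exists (t%:Z *: const_mx 1 + (4 * t%:Z + 1) *: Z^T - Z^T *m K).
have -> : S^T *m K = m%:Z *: const_mx 1 + 2 *: (Z^T *m K).
  rewrite [in LHS]SZ linearD linearZ /= trmx_const mulmxDl -scalemxAl.
  rewrite -(block_mx_const m m m m) mulmx_block !mulmx0 addr0 add0r.
  rewrite !mulmx_const scale_block_mx !scalemx_const.
  by congr (block_mx _ _ _ _ + _); congr const_mx; lia.
apply/matrixP=> i j; rewrite [in RHS]SZ !mxE; ring.
Qed.


(** In 2ST the coefficient of [K] is 2(4t + 1) - 4t - 2m = 0. In T + T^T, the terms [S *m K] cancel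
    because S^T = 2I - S and [S] commutes with [K]. *)
Lemma skew_EW_complement_spec (T : 'M[int]_(m + m)) :
    2 *: T = (4 * t%:Z + 1) *: S^T - S^T *m K ->
  S *m T = N%:M /\ T + T^T = (4 * t%:Z + 1)%:M - K.
Proof.
move=> defT.
split; apply: scalemx2_inj.
  rewrite scalemxAr defT mulmxBr -scalemxAr mulmxA gramE mulmxDl.
  rewrite -scalemxAl half_ones_sqr mul_scalar_mx.
  move: K => J; apply/matrixP=> i j; rewrite !mxE natz.
  by move: (J i j) (i == j) => x [] /=; lia.
rewrite scalerDr -[2 *: T^T]linearZ /= defT linearB linearZ /= trmx_mul trmxK.
rewrite half_ones_tr -skew_EW_comm.
have -> : S^T = 2 *: 1%:M - S by apply/eqP; rewrite eq_sym subr_eq addrC -hskew.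
rewrite mulmxBl -scalemxAl mul1mx.
move: (S *m K) => SJ; move: K => J; apply/matrixP=> i j; rewrite !mxE.
by move: (J i j) (S i j) (SJ i j) (i == j) => x y z [] /=; lia.
Qed.

(** * Divisibility constraints on the diagonal of a Smith decomposition *)

Section Smith.

Variables (L R T : 'M[int]_(m + m)) (d : seq int).
Local Notation D := (\matrix_(i < m + m, j < m + m) (d`_i *+ (i == j :> nat))).
Hypotheses (uL : L \in unitmx) (uR : R \in unitmx) (d_sorted : sorted dvdz d).
Hypothesis (defS : S = L *m D *m R).
Hypothesis (defT : 2 *: T = (4 * t%:Z + 1) *: S^T - S^T *m K).

Let Q := R *m T *m L.
Let ST : S *m T = N%:M := (skew_EW_complement_spec defT).1.
Let TT : T + T^T = (4 * t%:Z + 1)%:M - K := (skew_EW_complement_spec defT).2.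

Lemma skew_EW_dQ (i j : 'I_(m + m)) : d`_i * Q i j = N *+ (i == j).
Proof.
have : D *m Q = N%:M.
  have -> : D *m Q = invmx L *m (S *m T) *m L.
    by rewrite /Q defS !mulmxA mulVmx // mul1mx.
  by rewrite ST mul_mx_scalar -scalemxAl mulVmx // scalemx1.
move: Q => P /matrixP/(_ i j); rewrite !mxE => <-.
rewrite (bigD1 i) //= big1 ?addr0 => [|k ki]; first by rewrite mxE eqxx.
by rewrite mxE eq_sym (inj_eq val_inj) (negbTE ki) mul0r.
Qed.

Let N_neq0 : N != 0.
Proof. by rewrite mulf_neq0 //; lia. Qed.

Lemma skew_EW_d_neq0 (i : nat) : (i < m + m)%N -> d`_i != 0.
Proof.
move=> lti; apply: contra N_neq0 => /eqP d0.
by have := skew_EW_dQ (Ordinal lti) (Ordinal lti); rewrite d0 mul0r eqxx mulrb => <-.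
Qed.

Lemma skew_EW_Q_off (i j : 'I_(m + m)) : i != j -> Q i j = 0.
Proof.
move=> ij; have := skew_EW_dQ i j; rewrite (negbTE ij) => /eqP.
by rewrite mulf_eq0 (negbTE (skew_EW_d_neq0 (ltn_ord i))) => /eqP.
Qed.

Lemma skew_EW_d_dvd (i j : nat) :
  (i <= j)%N -> (j < m + m)%N -> (d`_i %| d`_j)%Z.
Proof.
(* Past the end of [d] the default entry is 0, which is excluded by nonvanishing. *)
move=> ij jn; have js : (j < size d)%N.
  by rewrite ltnNge; apply: contra (skew_EW_d_neq0 jn) => /(nth_default 0) ->.
apply: (sorted_leq_nth dvdz_trans dvdzz) => //; rewrite inE //.
exact: leq_ltn_trans js.
Qed.

Lemma skew_EW_Q_dvd (i j : 'I_(m + m)) : (i <= j)%N -> (Q j j %| Q i i)%Z.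
Proof.
move=> ij; have /dvdzP[c dc] := skew_EW_d_dvd ij (ltn_ord j).
have := skew_EW_dQ j j; have := skew_EW_dQ i i; rewrite !eqxx !mulrb => <-.
rewrite dc (mulrC c) -mulrA => /(mulfI (skew_EW_d_neq0 (ltn_ord i))).
by move=> e; apply/dvdzP; exists c; rewrite -e.
Qed.

(** The first entry divides all of [D], hence all of [S], whose diagonal is 1. *)
Lemma skew_EW_d0 : (d`_0 %| 1%R)%Z.
Proof.
have n_gt0 : (0 < m + m)%N by lia.
have [Z defD] : exists Z, D = d`_0 *: Z.
  apply: dvdz_mx => i j; rewrite mxE; case: eqP => // _; rewrite ?dvdz0 //.
  exact: skew_EW_d_dvd.
have := skew_EW_diag (Ordinal n_gt0).
rewrite defS defD -scalemxAr -scalemxAl mxE => <-; exact: dvdz_mulr.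
Qed.

Lemma skew_EW_d1 : (2 %| d`_1)%Z.
Proof.
have n_gt0 : (0 < m + m)%N by lia.
have n_gt1 : (1 < m + m)%N by lia.
have [_ pmS _ _] := hEW.
have [Z SZ] : exists Z, S - const_mx 1 = 2 *: Z.
  by apply: dvdz_mx => i j; rewrite !mxE; case: (pmS i j) => ->.
(* The all-ones matrix is a column times a row, so [D] has rank one modulo 2 and 2 divides d_0
   d_1. *)
have defD : D = (invmx L *m const_mx 1 : 'cV_(m + m)) *m (const_mx 1 *m invmx R)
    + 2 *: (invmx L *m Z *m invmx R).
  rewrite mulmxA -(mulmxA (invmx L)) mulmx_const !mulr1.
  rewrite scalemxAl scalemxAr -SZ -mulmxDl -mulmxDr addrC subrK.
  by rewrite defS !mulmxA mulVmx // mul1mx -mulmxA mulmxV // mulmx1.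
have := rank1_diag (i := Ordinal n_gt0) (j := Ordinal n_gt1) defD.
rewrite !mxE /= => /(_ erefl).
have : coprimez 2 d`_0 by exact: (coprimez_dvdr skew_EW_d0).
by move=> /Gauss_dvdzr ->.
Qed.

(** The last diagonal entry divides all of [Q], hence all of [T], and two entries of [T] add up to
    -1. *)
Lemma skew_EW_Q_last (i : 'I_(m + m)) :
  (forall j : 'I_(m + m), j <= i)%N -> (Q i i %| 1%R)%Z.
Proof.
move=> imax.
have [Z defQ] : exists Z, Q = Q i i *: Z.
  apply: dvdz_mx => k l; have [->|/skew_EW_Q_off ->] := eqVneq k l.
    exact: skew_EW_Q_dvd.
  exact: dvdz0.
have QT k l : (Q i i %| T k l)%Z.
  have -> : T = invmx R *m Q *m invmx L.
    by rewrite /Q !mulmxA mulVmx // mul1mx -mulmxA mulmxV // mulmx1.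
  rewrite [in X in _ *m X *m _]defQ -scalemxAr -scalemxAl mxE.
  exact: dvdz_mulr.
have [b _ STK] := skew_EW_trmul.
have m_gt0 : (0 < m)%N by lia.
have m_gt1 : (1 < m)%N by lia.
pose i0 := lshift m (Ordinal m_gt0); pose i1 := lshift m (Ordinal m_gt1).
have T2 k l : 2 * T (lshift m k) (lshift m l) =
    (4 * t%:Z + 1) * S (lshift m l) (lshift m k) - 1.
  have := congr1 (fun A : 'M_(m + m) => A (lshift m k) (lshift m l)) defT.
  have : (S^T *m K) (lshift m k) (lshift m l) = 1.
    by rewrite STK block_mxEul mxE.
  by move: (S^T *m K) => P P1; rewrite !mxE P1.
have T00 : T i0 i0 = 2 * t%:Z.
  by have := T2 (Ordinal m_gt0) (Ordinal m_gt0); rewrite skew_EW_diag -/i0;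
    move: (T i0 i0) => x; lia.
(* By skewness one of [S i0 i1], [S i1 i0] is -1; the transposed entry of [T] is then (-(4t + 1) -
   1) / 2. *)
have [k [l Tkl]] : exists k l, T k l = - (2 * t%:Z + 1).
  have [_ pmS _ _] := hEW.
  have : S i0 i1 + S i1 i0 = 0.
    by move/matrixP/(_ i0 i1): hskew; rewrite !mxE.
  case: (pmS i0 i1) => S01; rewrite S01 => S10.
    exists i0, i1; have := T2 (Ordinal m_gt0) (Ordinal m_gt1).
    by move: S10; rewrite -/i0 -/i1; move: (S i1 i0) (T i0 i1) => x y; nia.
  exists i1, i0; have := T2 (Ordinal m_gt1) (Ordinal m_gt0).
  by rewrite -/i0 -/i1 S01; move: (T i1 i0) => x; lia.
have -> : 1 = - (T i0 i0 + T k l) by rewrite T00 Tkl; ring.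
by rewrite rpredN rpredD.
Qed.

(** Modulo 4t + 1 one has b^2 = -1, so -S^T K becomes [u *m v]; the constant 2 in [Z] absorbs b^2 +
    1 = 2(4t + 1). The factor 4 comes from applying [rank1_diag] to 2Q. *)
Lemma skew_EW_Q_pair (i j : 'I_(m + m)) :
  i != j -> ((4 * t%:Z + 1)%R %| (4 * (Q i i * Q j j))%R)%Z.
Proof.
move=> ij; have [b b2 STK] := skew_EW_trmul.
pose u : 'cV[int]_(m + m) := col_mx (const_mx 1) (const_mx b).
pose v : 'rV[int]_(m + m) := row_mx (const_mx (-1)) (const_mx b).
pose Z : 'M[int]_(m + m) := S^T - block_mx 0 0 0 (const_mx 2).
have T2 : 2 *: T = u *m v + (4 * t%:Z + 1) *: Z.
  rewrite defT scalerBr addrCA; congr (_ + _).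
  rewrite STK mul_col_row !mulmx_const opp_block_mx !scale_block_mx.
  rewrite opp_block_mx add_block_mx.
  by congr block_mx; apply/matrixP=> k l; rewrite !mxE; nia.
have Q2 : 2 *: Q = (R *m u) *m (v *m L) + (4 * t%:Z + 1) *: (R *m Z *m L).
  rewrite /Q scalemxAl scalemxAr T2 mulmxDr mulmxDl !mulmxA.
  by rewrite -!scalemxAr -!scalemxAl.
have Q2ij : (2 *: Q) i j = 0 by rewrite mxE skew_EW_Q_off // mulr0.
have := rank1_diag Q2 Q2ij.
by rewrite [(2 *: Q) i i]mxE [(2 *: Q) j j]mxE mulrACA.
Qed.

Lemma skew_EW_d_upper (i : nat) : (i < 4 * t + 1)%N -> (d`_i %| 2 * t%:Z)%Z.
Proof.
move=> ltit.
have ltj : (4 * t < m + m)%N by lia.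
have ltn : (4 * t + 1 < m + m)%N by lia.
pose j := Ordinal ltj; pose k := Ordinal ltn.
have jk : j != k by rewrite -val_eqE /=; lia.
apply: dvdz_trans (_ : d`_j %| _)%Z; first by apply: skew_EW_d_dvd => //=; lia.
have Qk : (Q k k %| 1%R)%Z.
  by apply: skew_EW_Q_last => l; have := ltn_ord l; rewrite /=; lia.
have : ((4 * t%:Z + 1)%R %| Q j j)%Z.
  have := skew_EW_Q_pair jk; rewrite Gauss_dvdzr; last first.
    (* Bezout relation (4t + 1) - t * 4 = 1. *)
    by apply/coprimezP; exists (1, - t%:Z) => /=; ring.
  rewrite Gauss_dvdzl //; apply: coprimez_dvdr Qk _.
  by rewrite coprimezE /= coprimen1.
case/dvdzP=> c Qj; have := skew_EW_dQ j j; rewrite eqxx mulrb Qj mulrA.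
have nz : 4 * t%:Z + 1 != 0 by lia.
by move/(mulIf nz) => e; apply/dvdzP; exists c; rewrite -e mulrC.
Qed.

Lemma skew_EW_Q_coprime (i : 'I_(m + m)) :
  (2 * t + 2 <= i)%N -> coprimez (Q i i) t.
Proof.
move=> lei; apply: contraT => /=; rewrite coprimezE /coprime /= => ncop.
have g_gt0 : (0 < gcdn `|Q i i| t)%N by rewrite gcdn_gt0 t_gt0 orbT.
set g := gcdn _ _ in ncop g_gt0; pose p := pdiv g.
have p_pr : prime p by apply: pdiv_prime; lia.
have pt : (p %| t)%N := dvdn_trans (pdiv_dvd g) (dvdn_gcdr _ _).
have pQ : (p%:Z %| Q i i)%Z by exact: dvdn_trans (pdiv_dvd g) (dvdn_gcdl _ _).
have lek : (2 * t + 3 <= m + m)%N by lia.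
(* The first 2t + 3 rows have indices at most 2t + 2 <= i, so their diagonal entries in [Q] are
   multiples of [Q i i], hence of [p]. *)
pose f := widen_ord lek.
have injf : injective f by move=> x y /(congr1 val) /= /val_inj.
pose X := rowsub f R; pose U := mx_mod p X.
have [Y XT] : exists Y, X *m T = p%:Z *: Y.
  apply: dvdz_mx => k l.
  have -> : X *m T = rowsub f (Q *m invmx L).
    by rewrite /X mul_rowsub_mx /Q -mulmxA mulmxV // mulmx1.
  rewrite !mxE rpred_sum // => j _; have [<-|/skew_EW_Q_off ->] := eqVneq (f k) j.
    apply: dvdz_mulr; apply: dvdz_trans pQ _; apply: skew_EW_Q_dvd.
    by have := ltn_ord k; rewrite /=; lia.
  by rewrite mul0r dvdz0.
have UU : U *m (1%:M - half_ones 'F_p m) *m U^T = 0.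
  have [s ts] := dvdnP pt.
  have XX : X *m (1%:M - K) *m X^T =
      p%:Z *: (Y *m X^T + (Y *m X^T)^T - (4 * s%:Z) *: (X *m X^T)).
    have -> : 1%:M - K = T + T^T - (4 * t%:Z)%:M.
      by rewrite TT addrAC -raddfB /= [_ + 1]addrC addrK.
    rewrite mulmxBr mulmxDr mulmxBl mulmxDl XT scalerBr scalerDr.
    rewrite -scalemxAl; congr (_ + _ - _).
      rewrite -[in RHS]linearZ /= scalemxAl -XT trmx_mul trmxK.
      by rewrite [in RHS]trmx_mul mulmxA.
    by rewrite mul_mx_scalar -scalemxAl scalerA; congr (_ *: _); lia.
  have := congr1 (@mx_mod p _ _) XX; rewrite mx_mod_scale0 // !mx_modM.
  by rewrite mx_mod_tr mx_modB mx_mod1 mx_mod_half_ones.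
(* The rank of I - K is at least 4t, but 4t + 2(2t + 3) exceeds 2n = 8t + 4. *)
have := isotropic_rank _ UU.
have := mxrank_add (1%:M - half_ones 'F_p m) (half_ones 'F_p m).
have := half_ones_rank 'F_p m; rewrite subrK mxrank1.
have -> : row_free U.
  by rewrite /U /mx_mod map_mxsub row_free_rowsub // mx_mod_unit.
by move: (\rank (half_ones _ _)) (\rank (_ - _)) => x y; lia.
Qed.

Lemma skew_EW_d_lower (i : nat) :
  (2 * t + 2 <= i)%N -> (i < m + m)%N -> (2 * t%:Z %| d`_i)%Z.
Proof.
move=> lei lti.
have /dvdzP[e de] : (2 %| d`_i)%Z.
  by apply: dvdz_trans skew_EW_d1 _; apply: skew_EW_d_dvd; lia.
have := skew_EW_dQ (Ordinal lti) (Ordinal lti); rewrite eqxx mulrb /= de.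
set q := Q _ _ => eq.
have : (t%:Z %| e * q)%Z.
  by apply/dvdzP; exists (4 * t%:Z + 1); lia.
rewrite Gauss_dvdzl; last first.
  by rewrite coprimez_sym; apply: skew_EW_Q_coprime.
by rewrite mulrC => te; apply: dvdz_mul.
Qed.

Lemma skew_EW_d_middle (i : nat) : (i <= 2 * t + 1)%N -> (d`_i %| 2)%Z.
Proof.
move=> lei; apply: (dvdz_trans (skew_EW_d_dvd lei _)); first by lia.
set k := (2 * t + 1)%N; have ltk : (k < m + m)%N by lia.
have /dvdzP[e de] : (2 %| d`_k)%Z.
  by apply: dvdz_trans skew_EW_d1 _; apply: skew_EW_d_dvd; lia.
have et : (e %| t%:Z)%Z.
  have := @skew_EW_d_upper k; rewrite de (mulrC e) dvdz_mul2l //; apply; lia.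
rewrite de -[X in (_ %| X)%Z]mul1r dvdz_mul2r //=.
apply: contraT => ne1.
have e_gt1 : (1 < `|e|)%N.
  have e_neq0 : e != 0.
    by apply: contra (skew_EW_d_neq0 ltk) => /eqP e0; rewrite de e0 mul0r.
  by move: ne1; rewrite dvdzE dvdn1; lia.
pose p := pdiv `|e|; have p_pr : prime p := pdiv_prime e_gt1.
have pe : (p%:Z %| e)%Z := pdiv_dvd `|e|.
have pt : (p%:Z %| t%:Z)%Z := dvdz_trans pe et.
(* Since k = m, the second half consists of the indices from [k] on, where 2p divides the diagonal
   entry. *)
pose X := rowsub (@rshift m m) (invmx L).
(* Keeping 2 beside [p] allows the two doubled identities below to be halved over the integers,
   which covers p = 2 as well. *)
have [Y XS] : exists Y, X *m S = (2 * p%:Z) *: Y.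
  apply: dvdz_mx => a b.
  have -> : X *m S = rowsub (@rshift m m) (D *m R).
    by rewrite mul_rowsub_mx [in LHS]defS -mulmxA mulKmx.
  rewrite mxE mxE rpred_sum // => c _; rewrite mxE.
  case: (_ == _); last by rewrite mul0r dvdz0.
  rewrite dvdz_mulr //; apply: (@dvdz_trans d`_k).
    by rewrite de mulrC; apply: dvdz_mul.
  by apply: skew_EW_d_dvd; rewrite ?ltn_ord //= /k; lia.
have XX : X *m X^T = p%:Z *: (Y *m X^T + (Y *m X^T)^T).
  apply: scalemx2_inj.
  have -> : 2 *: (X *m X^T) = X *m (S + S^T) *m X^T.
    by rewrite hskew -scalemxAr mulmx1 -scalemxAl.
  rewrite mulmxDr mulmxDl XS scalerA scalerDr -scalemxAl; congr (_ + _).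
  by rewrite -linearZ /= scalemxAl -XS trmx_mul trmxK trmx_mul mulmxA.
have [s ts] := dvdzP pt.
have XK : X *m K = p%:Z *: (Y *m S^T - (2 * s) *: X).
  apply: scalemx2_inj.
  have -> : 2 *: (X *m K) = X *m S *m S^T - (4 * t%:Z) *: X.
    rewrite -mulmxA gramE mulmxDr mul_mx_scalar -scalemxAr.
    by rewrite [X in _ = X - _]addrC addrK.
  rewrite XS -scalemxAl; move: (Y *m S^T) => W.
  by apply/matrixP=> a b; rewrite !mxE ts; ring.
pose U := mx_mod p X; pose E := half_sums 'F_p m.
have UU : U *m U^T = 0.
  by rewrite -mx_mod_tr -mx_modM XX mx_mod_scale0.
have m1 : m%:R = 1 :> 'F_p.
  have /eqP t0 : t%:R == 0 :> 'F_p by rewrite -(dvdn_pcharf (pchar_Fp p_pr)).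
  by rewrite natrD natrM t0 mulr0 add0r.
have EE : E *m E^T = 1%:M by rewrite half_sums_gram m1.
(* From E E^T = I follows E^T = E^T E E^T = K E^T, so it suffices that [U] kills [K]. *)
have UE : U *m E^T = 0.
  have UK : U *m half_ones 'F_p m = 0.
    by rewrite -mx_mod_half_ones -mx_modM XK mx_mod_scale0.
  by rewrite -[E^T]mulmx1 -EE (mulmxA E^T) -half_onesE mulmxA UK mul0mx.
have rU : row_free U.
  rewrite /U /mx_mod map_mxsub row_free_rowsub //; first exact: rshift_inj.
  by rewrite mx_mod_unit // unitmx_inv.
have sUker : (U <= kermx U^T)%MS by apply/sub_kermxP.
have sEker : (E <= kermx U^T)%MS.
  by apply/sub_kermxP; rewrite -[E]trmxK -trmx_mul UE trmx0.
(* The kernel has dimension n - m = m, the rank of [U], so [U] is its own orthogonal. *)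
have skerU : (kermx U^T <= U)%MS.
  rewrite -(mxrank_leqif_sup sUker) mxrank_ker mxrank_tr (eqP rU).
  by apply/eqP; lia.
have /submxP[C EC] := submx_trans sEker skerU.
(* E = C U would give E E^T = C U E^T = 0. *)
have := EE; rewrite [X in X *m _]EC -mulmxA UE mulmx0.
move/matrixP/(_ (lshift 1 0) (lshift 1 0)); rewrite !mxE eqxx => /esym/eqP.
by rewrite oner_eq0.
Qed.

(** Divisibility both ways fixes each entry up to sign. At index 4t + 1 it holds because the last
    entry of [Q] is a unit. *)
Lemma skew_EW_smith_factor (i : nat) :
  (i < m + m)%N -> `|d`_i| = (skew_EW_factors t)`_i.
Proof.
move=> lti; rewrite nth_skew_EW_factors //.
have norm_eq (x y : int) : 0 <= y -> (x %| y)%Z -> (y %| x)%Z -> `|x| = y.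
  rewrite !dvdzE => y0 xy yx.
  have : (absz x == absz y)%N by rewrite eqn_dvd xy yx.
  by lia.
have even : (0 < i)%N -> (2 %| d`_i)%Z.
  by move=> i_gt0; apply: dvdz_trans skew_EW_d1 _; apply: skew_EW_d_dvd.
case: eqP => [->|i_neq0]; first by apply: norm_eq => //; apply: skew_EW_d0.
case: ifP => lei.
  by apply: norm_eq; [|exact: skew_EW_d_middle|apply: even; lia].
case: ifP => lei2.
  by apply: norm_eq; [lia|exact: skew_EW_d_upper|apply: skew_EW_d_lower; lia].
have := skew_EW_dQ (Ordinal lti) (Ordinal lti); rewrite eqxx mulrb /=.
have : (Q (Ordinal lti) (Ordinal lti) %| 1%R)%Z.
  by apply: skew_EW_Q_last => l; have := ltn_ord l; rewrite /=; lia.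
move: (Q _ _) => q /dvdzP[c cq] dq; apply: norm_eq; first by lia.
  by rewrite -dq dvdz_mulr.
by apply/dvdzP; exists c; rewrite -dq mulrC -mulrA (mulrC q) -cq mulr1.
Qed.

End Smith.

End SkewEW.

(** * Sign normalization and the final equivalence *)

Theorem theorem1p3 (t : nat) (ht : (0 < t)%N)
    (S : 'M[int]_((2 * t + 1) + (2 * t + 1)))
    (hEW : EW_matrix S) (hskew : skew_pm1 S) :
  is_Smith_normal_form S (diag_of_seq _ (skew_EW_factors t)).
Proof.
have [L uL [R uR [d d_sorted defS]]] := int_Smith_normal_form S.
have [T defT] := skew_EW_complement ht hEW.
have sE := skew_EW_smith_factor ht hEW hskew uL uR d_sorted defS defT.
have d_dvd := skew_EW_d_dvd ht hEW hskew uL uR d_sorted defS defT.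
have DE (i : 'I_(2 * t + 1 + (2 * t + 1))) :
    diag_of_seq _ (skew_EW_factors t) i i = `|d`_i| :> int.
  by rewrite !mxE eqxx mulrb sE ?ltn_ord.
split; first exact: diag_mx_is_diag.
- by move=> i; rewrite DE normr_ge0.
- move=> i j ij; rewrite !DE dvdzE !absz_id; apply: d_dvd => //.
  by rewrite ij.
(* The decomposition leaves the signs of [d] free. This matrix makes them positive and is an
   involution because no entry vanishes. *)
pose sgn : 'M[int]_(2 * t + 1 + (2 * t + 1)) := diag_mx (\row_i Num.sg d`_i).
have dn0 := skew_EW_d_neq0 ht hEW hskew uL uR d_sorted defS defT.
have sgn2 : sgn *m sgn = 1%:M.
  rewrite mulmx_diag -diag_const_mx; congr diag_mx.
  by apply/rowP=> i; rewrite !mxE -expr2 sqr_sg dn0.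
exists (sgn *m invmx L), (invmx R); split; rewrite ?unitmx_inv //.
  by rewrite unitmx_mul unitmx_inv uL andbT; case: (mulmx1_unit sgn2).
rewrite [in RHS]defS !mulmxA mulmxKV // mulmxK //.
rewrite mul_diag_mx; apply/matrixP=> i j; rewrite !mxE.
rewrite -(inj_eq val_inj i j) !mulrb; case: ifP => _; last by rewrite mulr0.
by rewrite -sE ?ltn_ord // normrEsg.
Qed.
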